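(* Let $\mathcal{P}$ be an LR-vine of dimension $\ell$ whose set of minimal elements is $[\ell]$. Define an edge-labeled graph $(G,\lambda)$ by: $N_G=[\ell]$; $E_G$ is the set of pairs $\{i,j\}\subseteq[\ell]$ with $i\neq j$ such that the join $i\vee j$ exists in $\mathcal{P}$ (equivalently, $E_G$ is the set of conditioned sets $C_v$ of non-minimal elements $v\in\mathcal{P}$); and $\lambda(i,j)=\operatorname{rk}_{\mathcal{P}}(i\vee j)-1$. Then $(G,\lambda)$ is an MAT-labeled graph. In particular, if $\mathcal{P}$ is an R-vine, then $(G,\lambda)$ is an MAT-labeled complete graph.
   Context: Posets are finite. A graded poset has a rank function $\operatorname{rk}\colon\mathcal{P}\to\mathbb{Z}_{>0}$ with $x<y\Rightarrow\operatorname{rk}(x)<\operatorname{rk}(y)$, $\operatorname{rk}(y)=\operatorname{rk}(x)+1$ when $y$ covers $x$, and all minimal elements of rank $1$; $\mathcal{P}_i$ = elements of rank $i$, $\dim(\mathcal{P})$ = number of minimal elements, $\mathcal{E}(v)$ = elements covered by $v$. A vine is a graded poset in which every non-minimal element covers exactly two elements, any two distinct elements of the same rank are covered by at most one common element, and for each $1\le i\le\operatorname{rk}(\mathcal{P})$ the graph $F_i$ on $\mathcal{P}_i$ with edge set $\{\mathcal{E}(v)\mid v\in\mathcal{P}_{i+1}\}$ is a forest. An R-vine is a vine with $\operatorname{rk}(\mathcal{P})=\dim(\mathcal{P})$, each $F_i$ a tree, and proximity: distinct elements of the same rank $i\ge2$ covered by a common element cover a common element. An LR-vine is a vine all of whose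 principal ideals $\mathcal{P}_{\le v}$ (induced order and rank) are R-vines. For $v\in\mathcal{P}$, $U_v$ is the set of minimal elements $\le v$; for non-minimal $v$ covering $a,b$, the conditioned set is $C_v=U_a\triangle U_b$. Graphs are finite simple undirected. For an edge-labeled graph $(G,\lambda)$, $\lambda\colon E_G\to\mathbb{Z}_{>0}$, $\pi_k=\lambda^{-1}(k)$; a conditioning vertex of $\{u,v\}\in\pi_k$ is a vertex $h$ with $\{u,h\},\{v,h\}$ edges of label $<k$. $\lambda$ is an MAT-labeling if for every $k$: (ML1) no edge of label $\le k$ forms a cycle with edges of label $k$; (ML2) every edge of label $k$ has exactly $k-1$ conditioning vertices. *)

(* Defs.v *)
From HB Require Import structures.
From mathcomp Require Import all_boot all_order.

Set Implicit Arguments.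
Unset Strict Implicit.
Unset Printing Implicit Defensive.

Import Order.TTheory.
Local Open Scope order_scope.

(* A finite simple graph with vertices in T is given by its vertex set
   N : {set T} and its edge set E : {set {set T}}. *)
Section Graphs.
Variable T : finType.
Implicit Types (N : {set T}) (E : {set {set T}}) (lam : {set T} -> nat).

Definition simple_graph N E : Prop :=
  forall e, e \in E -> #|e| = 2%N /\ e \subset N.

Definition complete_graph N E : Prop :=
  E = [set e : {set T} | (e \subset N) && (#|e| == 2%N)].

Definition adj E : rel T := fun x y => [set x; y] \in E.

Definition cycle_edges (c : seq T) : {set {set T}} :=
  [set [set x; next c x] | x in c].

(* A graph cycle, listed by its (at least three, distinct) vertices in order. *)
Definition graph_cycle E (c : seq T) : Prop :=
  (2 < size c)%N /\ ucycle (adj E) c.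

Definition forest N E : Prop :=
  simple_graph N E /\ forall c, ~ graph_cycle E c.

Definition tree N E : Prop :=
  [/\ forest N E, N != set0
    & forall x y, x \in N -> y \in N -> connect (adj E) x y].

(* Labels are only meaningful on edges: values of lam outside E are junk. *)
Definition edge_labeled_graph N E lam : Prop :=
  simple_graph N E /\ forall e, e \in E -> (0 < lam e)%N.

Definition conditioning_vertices E lam (e : {set T}) : {set T} :=
  [set h | [forall u in e,
     ([set u; h] \in E) && (lam [set u; h] < lam e)%N]].

Definition ML1 E lam (k : nat) : Prop :=
  forall e c, e \in E -> (lam e <= k)%N ->
    graph_cycle E c -> e \in cycle_edges c ->
    ~ (forall f, f \in cycle_edges c -> f != e -> lam f = k).

Definition ML2 E lam (k : nat) : Prop :=
  forall e, e \in E -> lam e = k ->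
    #|conditioning_vertices E lam e| = k.-1.

Definition MAT_labeling E lam : Prop :=
  forall k, (0 < k)%N -> ML1 E lam k /\ ML2 E lam k.

Definition MAT_labeled_graph N E lam : Prop :=
  edge_labeled_graph N E lam /\ MAT_labeling E lam.

End Graphs.

(* A finite poset is a subset S of a finPOrderType with the induced order, so
   that principal ideals are again posets in this sense; the rank function is
   rk restricted to S. *)
Section Vines.
Variables (d : Order.disp_t) (P : finPOrderType d).
Implicit Types (S : {set P}) (rk : P -> nat).

Definition minimals S : {set P} :=
  [set x in S | [forall y in S, ~~ (y < x)]].

Definition covers S (y x : P) : bool :=
  [&& x \in S, y \in S, x < y & [forall z in S, ~~ (x < z < y)]].

Definition lower_covers S (v : P) : {set P} := [set x | covers S v x].

Definition ideal S (v : P) : {set P} := [set x in S | x <= v].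

Record graded S rk : Prop := Graded {
  graded_pos : forall x, x \in S -> (0 < rk x)%N;
  graded_lt : forall x y, x \in S -> y \in S -> x < y -> (rk x < rk y)%N;
  graded_cover : forall x y, covers S y x -> rk y = (rk x).+1;
  graded_min : forall x, x \in minimals S -> rk x = 1%N }.

Definition level S rk (i : nat) : {set P} := [set x in S | rk x == i].

Definition poset_rank S rk : nat := (\max_(x in S) rk x)%N.

Definition poset_dim S : nat := #|minimals S|.

(* The edge set of the graph F_i, whose vertex set is level S rk i. *)
Definition level_edges S rk (i : nat) : {set {set P}} :=
  [set lower_covers S v | v in level S rk i.+1].

Record vine S rk : Prop := Vine {
  vine_graded : graded S rk;
  vine_covers : forall v, v \in S -> v \notin minimals S ->
    #|lower_covers S v| = 2%N;
  vine_unique : forall x y, x \in S -> y \in S -> x != y -> rk x = rk y ->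
    forall v w, covers S v x -> covers S v y ->
                covers S w x -> covers S w y -> v = w;
  vine_forest : forall i, (1 <= i <= poset_rank S rk)%N ->
    forest (level S rk i) (level_edges S rk i) }.

Definition proximity S rk : Prop :=
  forall x y, x \in S -> y \in S -> x != y -> rk x = rk y -> (2 <= rk x)%N ->
    (exists v, covers S v x /\ covers S v y) ->
    exists w, covers S x w /\ covers S y w.

Record R_vine S rk : Prop := RVine {
  R_vine_vine : vine S rk;
  R_vine_rank : poset_rank S rk = poset_dim S;
  R_vine_tree : forall i, (1 <= i <= poset_rank S rk)%N ->
    tree (level S rk i) (level_edges S rk i);
  R_vine_proximity : proximity S rk }.

Definition LR_vine S rk : Prop :=
  vine S rk /\ forall v, v \in S -> R_vine (ideal S v) rk.

Definition U_set S (v : P) : {set P} := [set x in minimals S | x <= v].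

Definition conditioned_set S (v : P) (C : {set P}) : Prop :=
  exists a b, [/\ a != b, lower_covers S v = [set a; b]
    & C = (U_set S a :\: U_set S b) :|: (U_set S b :\: U_set S a)].

Definition is_lub (A : {set P}) (z : P) : bool :=
  [forall x in A, x <= z] &&
  [forall w, [forall x in A, x <= w] ==> (z <= w)].

(* In the following, m : 'I_l -> P enumerates the minimal elements of P; it
   realizes the identification of the set of minimal elements with [l]. *)
Definition vine_edges l (m : 'I_l -> P) : {set {set 'I_l}} :=
  [set e : {set 'I_l} | (#|e| == 2%N) && [exists z, is_lub (m @: e) z]].

Definition vine_label rk l (m : 'I_l -> P) (e : {set 'I_l}) : nat :=
  if [pick z | is_lub (m @: e) z] is Some z then (rk z).-1 else 0%N.

End Vines.

(* Main.v *)
(** In a forest, two paths leaving a vertex x and ending at vertices that are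
    connected without passing through x begin with the same edge.  The levels of
    a principal ideal being connected, this lifts an element x <= u, v to a cover
    of x below u and v as soon as x is not the only place where the traces of the
    two ideals on the level of x are linked.  Lifting repeatedly shows that two
    minimal elements below u and v have a common upper bound below u and v, so
    that bounded pairs have joins, and that there is no cyclic sequence of
    n >= 3 principal ideals in which each element of a sequence of equal rank
    lies exactly in two consecutive ones: lifting would never stop.

    For n = 3 this identifies the conditioning vertices of {i, j} with the
    minimal elements below i v j other than i, j, which gives (ML2) because
    #|U_v| = rk v.  A shortest violation of (ML1) has no chord of small label,
    hence its joins would form such a cyclic sequence.

    An R-vine has the same two properties: connectedness of the levels of ideals
    follows from proximity by descending induction on the level, and
    #|U_v| = rk v from U_a :&: U_b = U_c for the lower covers a, b of v and their
    common lower cover c. *)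

Require Import Defs.
From mathcomp Require Import all_boot all_order.
From mathcomp Require Import zify.

Set Implicit Arguments.
Unset Strict Implicit.
Unset Printing Implicit Defensive.

Import Order.TTheory.
Local Open Scope order_scope.

(* [lia] does not terminate in reasonable time on hypotheses comparing elements
   of [P], so everything but the arithmetic of ranks is cleared first. *)
Ltac nat_lia := try assumption;
  repeat match goal with
  | H : ?A |- _ => lazymatch A with
    | @eq ?T _ _ => tryif unify T nat then fail else clear H
    | is_true ?b => lazymatch b with
      | context [@Order.le] => clear H
      | context [@Order.lt] => clear H
      | context [@in_mem] => clear H
      | leq _ _ => fail
      | andb _ _ => fail
      | orb _ _ => fail
      | negb (@eq_op _ _ _) => fail
      | @eq_op _ _ _ => fail
      | _ => clear H
      end
    | _ => clear H
    end
  end; lia.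

Lemma modn_add_neq n t a : (0 < a < n)%N -> (t + a)%N <> t %[mod n].
Proof.
move=> /andP[a0 an]; rewrite -{2}[t]addn0 => /eqP; rewrite eqn_modDl.
by rewrite mod0n modn_small //; case: a a0 {an}.
Qed.

(** * Paths in forests *)

Section Forests.
Variable T : finType.
Implicit Types (e : rel T) (x y : T).

Definition avoiding e x : rel T := [rel u v | [&& u != x, v != x & e u v]].

Lemma avoiding_sub e e' x :
  subrel e e' -> subrel (connect (avoiding e x)) (connect (avoiding e' x)).
Proof.
move=> ee'; apply: connect_sub => u v /and3P[ux vx uv].
by apply: connect1; apply/and3P; split=> //; apply: ee'.
Qed.

(** A path without repeated vertices never returns to its start. *)
Lemma connect_first_step e x y : x != y -> connect e x y ->
  exists2 p, e x p & connect (avoiding e x) p y.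
Proof.
move=> xy /connectP[s es ey]; rewrite ey in xy *.
case/shortenP: es xy => -[|p s'] /=; first by rewrite eqxx.
case/andP=> xp ps' /andP[xs' _] _ _; exists p => //.
apply/connectP; exists s' => //.
elim: s' p {xp} ps' xs' => //= q s' IH p /andP[pq qs'].
rewrite !inE !negb_or => /and3P[xp xq xs'].
apply/andP; split; first by apply/and3P; split; rewrite // eq_sym.
by apply: IH; rewrite // inE negb_or xq.
Qed.

(** If [p] and [q] differed, a simple path between them that misses [x] would close up through [x]
    to a cycle. *)
Lemma forest_branch N E x p q : forest N E -> adj E x p -> adj E x q ->
  connect (avoiding (adj E) x) p q -> p = q.
Proof.
case=> simpE acyclicE xp xq; case: (eqVneq p q) => // pq /connectP[s ps eq_q].
subst q; have px : p != x.
  by have [] := simpE _ xp; rewrite cards2 eq_sym; case: eqP.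
case/shortenP: ps pq xq => s' ps' us' _ pq xq.
case: (acyclicE (x :: p :: s')); split.
  by case: s' pq {ps' us' xq} => //=; rewrite eqxx.
rewrite /ucycle /= rcons_path xp /=; apply/andP; split.
  apply/andP; split; last by rewrite /adj setUC.
  by apply: sub_path ps' => u v /and3P[].
apply/andP; split => //; rewrite inE negb_or eq_sym px /=.
elim: s' p ps' {us' xq xp px pq} => //= z s' IH p /andP[/and3P[_ zx _]].
by rewrite inE negb_or eq_sym zx; apply: IH.
Qed.

(** Meant for [e1] and [e2] the edges contributed by two principal ideals, while the link between
    [y] and [y'] may use any edges of the forest. *)
Lemma forest_common_first_step N E e1 e2 x y y' : forest N E ->
    subrel e1 (adj E) -> subrel e2 (adj E) -> x != y -> x != y' ->
    connect e1 x y -> connect e2 x y' -> connect (avoiding (adj E) x) y y' ->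
  exists2 p, e1 x p & e2 x p.
Proof.
move=> forE s1 s2 xy xy' c1 c2 c0.
have [p xp py] := connect_first_step xy c1.
have [q xq qy] := connect_first_step xy' c2.
exists p => //; suff -> : p = q by [].
apply: (forest_branch forE (s1 _ _ xp) (s2 _ _ xq)).
apply: connect_trans (avoiding_sub s1 py) _; apply: connect_trans c0 _.
rewrite sym_connect_sym; first exact: avoiding_sub qy.
by move=> u v; rewrite /avoiding /= andbCA /adj setUC.
Qed.

End Forests.

(** * Ranks and covers in a vine *)

Section VineTheory.
Variables (d : Order.disp_t) (P : finPOrderType d) (rk : P -> nat).
Implicit Types x y z u v w : P.
Local Notation S := [set: P].
Hypothesis V : vine S rk.
Let G := vine_graded V.

Lemma rk_gt0 x : (0 < rk x)%N. Proof. by apply: graded_pos G _ _. Qed.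
Lemma rk_lt x y : x < y -> (rk x < rk y)%N. Proof. exact: graded_lt G _ _ _ _. Qed.

Lemma rk_le x y : x <= y -> (rk x <= rk y)%N.
Proof. by rewrite le_eqVlt => /predU1P[->|/rk_lt/ltnW]. Qed.

Lemma le_rk_eq x y : x <= y -> (rk y <= rk x)%N -> x = y.
Proof. by rewrite le_eqVlt => /predU1P[//|/rk_lt]; rewrite ltnNge => /negbTE->. Qed.

Lemma covers_lt y x : covers S y x -> x < y. Proof. by case/and4P. Qed.

Lemma covers_rk y x : covers S y x -> rk y = (rk x).+1.
Proof. exact: graded_cover G _ _. Qed.

Lemma lt_cover_below x v : x < v -> exists2 a, covers S v a & x <= a.
Proof.
move=> xv; have p0 : (x <= x) && (x < v) by rewrite lexx.
case: (@arg_maxnP _ x (fun a => (x <= a) && (a < v)) rk p0) => a /andP[xa av] am.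
exists a => //; rewrite /covers !inE av /=; apply/forallP => z; rewrite inE /=.
apply/andP => -[az zv]; have := am z; rewrite zv (ltW (le_lt_trans xa az)) /=.
by move=> /(_ isT); have := rk_lt az; nat_lia.
Qed.

Lemma lt_cover_above x v : x < v -> exists2 a, covers S a x & a <= v.
Proof.
move=> xv; have p0 : (x < v) && (v <= v) by rewrite lexx xv.
case: (@arg_minnP _ v (fun a => (x < a) && (a <= v)) rk p0) => a /andP[xa av] am.
exists a => //; rewrite /covers !inE xa /=; apply/forallP => z; rewrite inE /=.
apply/andP => -[xz za]; have := am z; rewrite xz (ltW (lt_le_trans za av)) /=.
by move=> /(_ isT); have := rk_lt za; nat_lia.
Qed.

Lemma mem_minimals x : (x \in minimals S) = (rk x == 1%N).
Proof.
apply/idP/eqP => [|r]; first exact: graded_min G _.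
rewrite !inE /=; apply/forallP => y; rewrite inE /=; apply/negP => /rk_lt.
by have := rk_gt0 y; nat_lia.
Qed.

Lemma lower_coversP v : (1 < rk v)%N -> exists a b,
  [/\ a != b, lower_covers S v = [set a; b], rk v = (rk a).+1, rk v = (rk b).+1
    & forall x, (x < v) = (x <= a) || (x <= b)].
Proof.
move=> rv; have /eqP/cards2P[a [b [ab e]]] : #|lower_covers S v| = 2%N.
  by apply: (vine_covers V); rewrite // mem_minimals; nat_lia.
have /[!inE] ca : a \in lower_covers S v by rewrite e set21.
have /[!inE] cb : b \in lower_covers S v by rewrite e set22.
exists a, b; split=> // [||x]; [exact: covers_rk ca|exact: covers_rk cb|].
 apply/idP/orP => [/lt_cover_below[y cy xy]|[]].
- have : y \in lower_covers S v by rewrite inE.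
  by rewrite e !inE => /orP[]/eqP<-; [left|right].
- by move/le_lt_trans; apply; apply: covers_lt.
- by move/le_lt_trans; apply; apply: covers_lt.
Qed.

Lemma lower_covers_ideal u z :
  z <= u -> lower_covers (ideal S u) z = lower_covers S z.
Proof.
move=> zu; apply/setP => x; rewrite !inE /covers !inE /=.
case: (boolP (x < z)) => xz; rewrite ?andbF //= zu (ltW (lt_le_trans xz zu)) /=.
apply/forallP/forallP => H y; have := H y; rewrite !inE /=; last first.
  by case: (y <= u) => //=.
case yz: (y < z); last by rewrite andbF.
by rewrite (ltW (lt_le_trans yz zu)).
Qed.

(** * Connectedness of the levels of principal ideals *)

Local Notation F u i := (adj (level_edges (ideal S u) rk i)).

Lemma ideal_adjP u i x p : reflect
  (exists z, [/\ z <= u, rk z = i.+1 & lower_covers S z = [set x; p]]) (F u i x p).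
Proof.
apply: (iffP imsetP) => [[z]|[z [zu rz e]]].
  by rewrite !inE /= => /andP[zu /eqP rz] ->; exists z; rewrite lower_covers_ideal.
by exists z; rewrite ?lower_covers_ideal // !inE zu rz /=.
Qed.

Lemma ideal_adj_sub u i : subrel (F u i) (adj (level_edges S rk i)).
Proof.
move=> x p /ideal_adjP[z [zu rz e]]; apply/imsetP; exists z => //.
by rewrite !inE rz /=.
Qed.

Lemma lower_covers_set2 z x p : lower_covers S z = [set x; p] ->
  covers S z x /\ covers S z p.
Proof.
by move=> e; have := set21 x p; have := set22 x p; rewrite -!e !inE.
Qed.

(** Beyond the vine axioms, the MAT conditions rest on this property and on [#|U_set S v| = rk v],
    which both kinds of vine have. *)
Definition connected_ideals := forall u x y,
  x <= u -> y <= u -> rk x = rk y -> connect (F u (rk x)) x y.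

Lemma siblings_connected u z x y : z <= u -> covers S z x -> covers S z y ->
  connect (F u (rk x)) x y.
Proof.
move=> zu zx zy; have rz := covers_rk zx.
have [|a [b [ab e ra rb H]]] := @lower_coversP z; first by have := rk_gt0 x; nat_lia.
have /[!inE] x' : x \in [set a; b] by rewrite -e inE.
have /[!inE] y' : y \in [set a; b] by rewrite -e inE.
case: (eqVneq x y) => [->//|xy]; apply/connect1/ideal_adjP.
exists z; split=> //; rewrite e; case/orP: x' y' xy => /eqP-> /orP[]/eqP-> //.
- by rewrite eqxx.
- by move=> _; rewrite setUC.
- by rewrite eqxx.
Qed.

(** A path one level up, between covers of [x] and [y], is pushed down: by proximity its consecutive
    vertices share a lower cover, and two lower covers of one vertex are equal or adjacent. *)
Lemma proximity_connected_ideals : proximity S rk -> connected_ideals.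
Proof.
move=> prox u x y; move: {2}(rk u - rk x)%N (leqnn (rk u - rk x)) => n.
elim: n x y => [|n IH] x y.
  move=> n0 xu yu xy; have -> : x = u by apply: le_rk_eq; nat_lia.
  by have -> : y = u by apply: le_rk_eq; nat_lia.
move=> nn xu yu xy.
case: (eqVneq x u) => [xE|xu'].
  have -> : y = u by apply: le_rk_eq; rewrite // -xE xy.
  by rewrite xE.
have yu' : y != u by apply: contraNneq xu' => yE; apply/eqP/le_rk_eq; rewrite // xy yE.
have [x' cx x'u] : exists2 x', covers S x' x & x' <= u.
  by apply: lt_cover_above; rewrite lt_neqAle xu'.
have [y' cy y'u] : exists2 y', covers S y' y & y' <= u.
  by apply: lt_cover_above; rewrite lt_neqAle yu'.
have rx := covers_rk cx; have ry := covers_rk cy.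
have nn' : (rk u - rk x' <= n)%N by nat_lia.
have rxy : rk x' = rk y' by rewrite rx ry xy.
have /connectP[s] := IH x' y' nn' x'u y'u rxy.
rewrite rx => ps ey'; rewrite {}ey' in cy {ry rxy y'u}.
elim: s x x' {xu xu' nn nn'} cx x'u rx ps xy cy => [|q s IHs] x x' cx x'u rx /=.
  by move=> _ _; apply: siblings_connected.
case/andP=> /ideal_adjP[z [zu rz e]] ps xy cy.
have [zx' zq] := lower_covers_set2 e.
have rzx := covers_rk zx'; have rzq := covers_rk zq.
have rq : rk q = rk x' by apply: succn_inj; rewrite -rzx -rzq.
(* Proximity concerns distinct elements; if [x' = q], the lower cover [x] of [x'] serves as [w]. *)
have [w [wx' wq]] : exists w, covers S x' w /\ covers S q w.
  case: (eqVneq x' q) => [<-|x'q]; first by exists x.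
  by apply: prox; rewrite ?inE ?rx ?ltnS ?rk_gt0 //; [rewrite rq|exists z].
have rwx : rk w = rk x by apply: succn_inj; rewrite -rx (covers_rk wx').
apply: connect_trans (siblings_connected x'u cx wx') _.
rewrite -rwx; apply: (IHs w q) => //; first 1 last.
- by rewrite rq rx rwx.
- by rewrite rwx.
- by rewrite rwx.
by apply: le_trans zu; apply/ltW/covers_lt.
Qed.

Lemma exists_le_of_rank v i : (0 < i <= rk v)%N -> exists2 y, y <= v & rk y = i.
Proof.
move: {2}(rk v - i)%N (leqnn (rk v - i)) => n; elim: n i => [|n IH] i ni iv.
  by exists v => //; nat_lia.
case: (eqVneq i (rk v)) => [->|iv']; first by exists v.
have [||y yv ry] := IH i.+1; [nat_lia|nat_lia|].
have [|a [b [_ _ ra _ H]]] := @lower_coversP y; first nat_lia.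
by exists a; [apply: ltW; apply: lt_le_trans yv; rewrite H lexx|nat_lia].
Qed.

Lemma level_forest x : forest (level S rk (rk x)) (level_edges S rk (rk x)).
Proof.
apply: (vine_forest V); rewrite rk_gt0 /=.
by apply: (leq_bigmax_cond (F := rk)); rewrite inE.
Qed.

(** * Lifting below two elements, and cycles of principal ideals *)

Hypothesis K : connected_ideals.

(** The traces of both ideals contain a common edge [{x, p}]. By [vine_unique] the elements inducing
    it in the two ideals coincide, so this cover of [x] lies below [u] and [v]. *)
Lemma lift_cover u v x y y' : x <= u -> y <= u -> x <= v -> y' <= v ->
    rk y = rk x -> rk y' = rk x -> x != y -> x != y' ->
    connect (avoiding (adj (level_edges S rk (rk x))) x) y y' ->
  exists z, [/\ rk z = (rk x).+1, x <= z, z <= u & z <= v].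
Proof.
move=> xu yu xv y'v ry ry' xy xy' c.
have [||p] := forest_common_first_step (level_forest x)
  (@ideal_adj_sub u _) (@ideal_adj_sub v _) xy xy' _ _ c; try exact: K.
move=> /ideal_adjP[z [zu rz e]] /ideal_adjP[z' [z'v rz' e']].
have [zx zp] := lower_covers_set2 e; have [z'x z'p] := lower_covers_set2 e'.
have rzp := covers_rk zp.
have xp : x != p.
  apply/eqP => xp; have [|a [b [ab ez _ _ _]]] := @lower_coversP z.
    by rewrite rz ltnS rk_gt0.
  have := cards2 a b; rewrite -ez e xp setUid cards1 ab => /eqP.
  by [].
have rxp : rk x = rk p by apply: succn_inj; rewrite -rz -rzp.
have zz' := vine_unique V (in_setT x) (in_setT p) xp rxp zx zp z'x z'p.
by exists z; split; rewrite // ?(ltW (covers_lt zx)) // zz'.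
Qed.

(** While [x] and [y] differ, each of them links the two ideals away from the other, so both lift by
    one rank; the ranks up to that of [u] run out. *)
Lemma common_upper_bound u v x y : x <= u -> x <= v -> y <= u -> y <= v ->
  rk x = rk y -> exists w, [/\ w <= u, w <= v, x <= w & y <= w].
Proof.
move: {2}(rk u - rk x)%N (leqnn (rk u - rk x)) => n.
elim: n x y => [|n IH] x y nn xu xv yu yv rxy.
  have xE : x = u by apply: le_rk_eq; nat_lia.
  have yE : y = u by apply: le_rk_eq; nat_lia.
  by exists x; rewrite yE -xE.
case: (eqVneq x y) => [<-|xy]; first by exists x.
have [x' [rx' xx' x'u x'v]] :=
  lift_cover xu yu xv yv (esym rxy) (esym rxy) xy xy (connect0 _ _).
have yx := xy; rewrite eq_sym in yx.
have [y' [ry' yy' y'u y'v]] := lift_cover yu xu yv xv rxy rxy yx yx (connect0 _ _).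
have rxy' : rk x' = rk y' by rewrite rx' ry' rxy.
have nn' : (rk u - rk x' <= n)%N by nat_lia.
have [w [wu wv x'w y'w]] := IH x' y' nn' x'u x'v y'u y'v rxy'.
by exists w; split=> //; [apply: le_trans x'w|apply: le_trans y'w].
Qed.

(** Edges coming from the ideal of [w] have both ends below [w], hence miss [x]. *)
Lemma connect_avoiding_ideal w x y y' : ~~ (x <= w) -> y <= w -> y' <= w ->
  rk y = rk x -> rk y' = rk x ->
  connect (avoiding (adj (level_edges S rk (rk x))) x) y y'.
Proof.
move=> xw yw y'w ry ry'.
have := K yw y'w; rewrite ry ry' => /(_ erefl).
apply: connect_sub => p q pq; apply: connect1.
have /ideal_adjP[z [zw _ e]] := pq; have [zp zq] := lower_covers_set2 e.
have le_w t : covers S z t -> t != x.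
  by move=> c; apply: contraNneq xw => <-; apply: le_trans zw; apply/ltW/covers_lt.
by apply/and3P; split; [exact: le_w|exact: le_w|exact: ideal_adj_sub pq].
Qed.

(** Indices are read modulo [n], so [v (t + n.-1)] is the predecessor of [v t]. The remaining ideals
    link the two neighbours of [i t] without passing through it, so [i t] lifts, and the lifted
    elements satisfy the same hypotheses one rank higher. *)
Lemma no_ideal_cycle n s (i v : nat -> P) : (2 < n)%N ->
    (forall t, rk (i t) = s) ->
    (forall t, v (t + n)%N = v t) ->
    (forall t, i t <= v t) -> (forall t, i t <= v (t + n.-1)%N) ->
    (forall t r, i t <= v r -> r = t %[mod n] \/ r.+1 = t %[mod n]) ->
  False.
Proof.
move=> n2; set R := poset_rank S rk.
(* The number of lifts still possible, as no rank exceeds [R]. *)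
have : (R < s + (R.+1 - s))%N by nat_lia.
move: (R.+1 - s)%N => k; elim: k s i => [|k IH] s i Rk ri vn iv ivn ivP.
  have : (rk (i 0%N) <= R)%N by apply: (leq_bigmax_cond (F := rk)); rewrite inE.
  by rewrite ri; nat_lia.
have ivS t : i t.+1 <= v t.
  by rewrite -vn; have -> : (t + n = t.+1 + n.-1)%N by nat_lia.
have lift t : exists z,
    [&& rk z == s.+1, i t <= z, z <= v t & z <= v (t + n.-1)%N].
  (* The way round from [i t.+1] to [i (t + n.-1)] uses the ideals from [v t.+1] to [v (t + n.-2)],
     none of which contains [i t]. *)
  have c j : (j < n.-1)%N -> connect
      (avoiding (adj (level_edges S rk (rk (i t)))) (i t)) (i t.+1) (i (t.+1 + j)%N).
    elim: j => [|j IHj] jn; first by rewrite addn0.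
    apply: connect_trans (IHj _) _; first nat_lia.
    apply: (@connect_avoiding_ideal (v (t.+1 + j)%N)); rewrite ?ri ?addnS //.
    apply/negP => /ivP []; rewrite addSnnS => h.
      by apply: (modn_add_neq _ h); nat_lia.
    by rewrite -addnS in h; apply: (modn_add_neq _ h); nat_lia.
  have := @lift_cover (v t) (v (t + n.-1)%N) (i t) (i t.+1) (i (t + n.-1)%N).
  rewrite !ri => /(_ (iv _) (ivS _) (ivn _) (iv _) erefl erefl).
  case=> [||| z [rz iz zv zv']].
  (* If [i t] equalled a neighbour, one of the two would lie below a third ideal of the cycle;
     [2 < n] excludes this. *)
  - apply/eqP => e; have := iv t.+1; rewrite -e => /ivP [].
      by rewrite -addn1 => h; apply: (modn_add_neq _ h); nat_lia.
    by rewrite -addn2 => h; apply: (modn_add_neq _ h); nat_lia.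
  - apply/eqP => e; have := iv t; rewrite e => /ivP [] h.
      by apply: (modn_add_neq _ (esym h)); nat_lia.
    have e' : (t + n.-1 = t.+1 + n.-2)%N by nat_lia.
    by rewrite e' in h; apply: (modn_add_neq _ (esym h)); nat_lia.
  - have -> : (t + n.-1 = t.+1 + n.-2)%N by nat_lia.
    by rewrite -(ri t); apply: c; nat_lia.
  by exists z; rewrite rz eqxx iz zv.
pose j t := xchoose (lift t).
have jP t : [&& rk (j t) == s.+1, i t <= j t, j t <= v t & j t <= v (t + n.-1)%N].
  exact: xchooseP (lift t).
apply: (IH s.+1 j) => // [|t|t|t|t r].
- nat_lia.
- by have /and4P[/eqP] := jP t.
- by have /and4P[] := jP t.
- by have /and4P[] := jP t.
- have /and4P[_ ij _ _] := jP t; move=> jr; apply: ivP; exact: le_trans jr.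
Qed.

(** Inclusion-exclusion on the lower covers [a] and [b]: with [r = rk v] the count is
    [2 (r - 1) - (r - 2) = r]. *)
Lemma proximity_card_U_set v : proximity S rk -> #|U_set S v| = rk v.
Proof.
move=> prox; move: {2}(rk v) (leqnn (rk v)) => n.
elim: n v => [|n IH] v nv; first by have := rk_gt0 v; nat_lia.
have U1 x w : x \in U_set S w = (rk x == 1%N) && (x <= w).
  by rewrite !inE -mem_minimals !inE.
case: (ltnP 1 (rk v)) => rv; last first.
  have rv1 : rk v = 1%N by have := rk_gt0 v; nat_lia.
  rewrite rv1 -(cards1 v); congr #|pred_of_set _|; apply/setP => x.
  rewrite U1 inE; apply/andP/eqP => [[/eqP rx xv]|->]; last by rewrite rv1.
  by apply: le_rk_eq; rewrite // rx rv1.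
have [a [b [ab e ra rb vE]]] := lower_coversP rv.
have [va vb] := lower_covers_set2 e.
have -> : U_set S v = U_set S a :|: U_set S b.
  apply/setP => x; rewrite in_setU !U1 -andb_orr -vE lt_neqAle.
  by case: (eqVneq x v) => [->|//]; case: eqP => // r; rewrite r in rv.
rewrite cardsU !IH; [|nat_lia|nat_lia].
suff -> : #|U_set S a :&: U_set S b| = (rk a).-1 by have := rk_gt0 a; nat_lia.
(* Two distinct minimal elements have nothing below both, which agrees with [(rk a).-1 = 0]. *)
case: (ltnP 1 (rk a)) => ra1; last first.
  have -> : (rk a).-1 = 0%N by nat_lia.
  apply/eqP; rewrite cards_eq0; apply/eqP/setP => x; rewrite inE !U1 inE.
  apply: contraNF ab => /andP[/andP[/eqP rx xa] /andP[_ xb]].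
  have <- : x = a by apply: le_rk_eq; nat_lia.
  by apply/eqP/le_rk_eq; nat_lia.
have [c [ac bc]] : exists c, covers S a c /\ covers S b c.
  by apply: prox; rewrite ?inE //; [nat_lia|exists v].
have rc := covers_rk ac.
(* Some [y <= c] has the rank of [x]. If [y] is not [x], it links the ideals of [a] and [b] away
   from [x], so [x] lifts; this must stop before the rank of [a]. *)
have below_c x : x <= a -> x <= b -> x <= c.
  move: {2}(rk a - rk x)%N (leqnn (rk a - rk x)) => k.
  have nab y : y <= a -> y <= b -> (rk y < rk a)%N.
    move=> ya yb; rewrite ltnNge; apply: contraNN ab => ry.
    have <- : y = a by apply: le_rk_eq; nat_lia.
    by apply/eqP/le_rk_eq; nat_lia.
  elim: k x => [|k IHk] x xk xa xb; have rx := nab _ xa xb; first nat_lia.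
  have [|y yc ry] := @exists_le_of_rank c (rk x); first by have := rk_gt0 x; nat_lia.
  case: (eqVneq x y) => [->//|xy].
  have ya : y <= a by apply: le_trans yc (ltW (covers_lt ac)).
  have yb : y <= b by apply: le_trans yc (ltW (covers_lt bc)).
  have [z [rz xz za zb]] := lift_cover xa ya xb yb ry ry xy xy (connect0 _ _).
  by apply: le_trans xz _; apply: IHk => //; nat_lia.
rewrite rc /= -(IH c); last nat_lia.
congr #|pred_of_set _|; apply/setP => x; rewrite in_setI !U1.
apply/andP/andP => [[/andP[rx xa] /andP[_ xb]]|[rx xc]].
  by split=> //; apply: below_c.
by rewrite rx (le_trans xc (ltW (covers_lt ac))) (le_trans xc (ltW (covers_lt bc))).
Qed.

(** * Joins of minimal elements and their lower covers *)

Hypothesis N : forall v, #|U_set S v| = rk v.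
Variables (l : nat) (m : 'I_l -> P).
Hypotheses (m_inj : injective m) (m_min : [set m i | i : 'I_l] = minimals S).
Local Notation D v := [set h | m h <= v].
Local Notation E := (vine_edges m).
Local Notation lam := (vine_label rk m).

Lemma rk_m i : rk (m i) = 1%N.
Proof. by apply/eqP; rewrite -mem_minimals -m_min imset_f. Qed.

Lemma U_setE v : U_set S v = m @: D v.
Proof.
apply/setP => x; rewrite [x \in U_set S v]inE -m_min.
apply/andP/imsetP => [[/imsetP[i _ ->] iv]|[i]]; first by exists i; rewrite ?inE.
by rewrite inE => iv ->; rewrite imset_f.
Qed.

Lemma card_below v : #|D v| = rk v.
Proof. by rewrite -N U_setE card_imset. Qed.

Lemma is_lubP i j z : reflect
  [/\ m i <= z, m j <= z & forall w, m i <= w -> m j <= w -> z <= w]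
  (is_lub (m @: [set i; j]) z).
Proof.
rewrite imsetU1 imset_set1.
apply: (iffP andP) => [[/'forall_implyP ub /'forall_implyP lb]|[iz jz lb]].
  split; [by apply: ub; rewrite set21|by apply: ub; rewrite set22|].
  move=> w iw jw; apply: lb; apply/'forall_implyP => x.
  by rewrite !inE => /orP[]/eqP->.
split; apply/'forall_implyP; [move=> x|move=> w /'forall_implyP ub].
  by rewrite !inE => /orP[]/eqP->.
by apply: lb; apply: ub; rewrite ?(set21, set22).
Qed.

Lemma lub_uniq i j z z' :
  is_lub (m @: [set i; j]) z -> is_lub (m @: [set i; j]) z' -> z = z'.
Proof.
move=> /is_lubP[iz jz lb] /is_lubP[iz' jz' lb'].
by apply/le_anti; rewrite lb ?lb'.
Qed.

Lemma vine_labelE i j z :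
  is_lub (m @: [set i; j]) z -> lam [set i; j] = (rk z).-1.
Proof.
move=> Hz; rewrite /vine_label; case: pickP => [z' Hz'|/(_ z)].
  by rewrite (lub_uniq Hz Hz').
by rewrite Hz.
Qed.

(** An upper bound [z] of least rank is the join: for any other upper bound [w],
    [common_upper_bound] gives one below both [z] and [w], and by minimality it is [z]. *)
Lemma lub_exists i j u : m i <= u -> m j <= u ->
  exists2 z, is_lub (m @: [set i; j]) z & z <= u.
Proof.
move=> iu ju; have p0 : (m i <= u) && (m j <= u) by rewrite iu.
case: (@arg_minnP _ u (fun a => (m i <= a) && (m j <= a)) rk p0).
move=> z /andP[iz jz] zmin.
have zlb w : m i <= w -> m j <= w -> z <= w.
  move=> iw jw; have := common_upper_bound iz iw jz jw.
  rewrite !rk_m => /(_ erefl) [y [yz yw iy jy]].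
  by rewrite -(le_rk_eq yz) // zmin // iy.
by exists z; [apply/is_lubP|apply: zlb].
Qed.

Lemma vine_edgeP e : e \in E -> exists i j z,
  [/\ e = [set i; j], i != j & is_lub (m @: [set i; j]) z].
Proof.
rewrite inE => /andP[/cards2P[i [j [ij ->]]] /existsP[z Hz]].
by exists i, j, z.
Qed.

Lemma mem_vine_edges i j z :
  i != j -> is_lub (m @: [set i; j]) z -> [set i; j] \in E.
Proof. by move=> ij Hz; rewrite inE cards2 ij /=; apply/existsP; exists z. Qed.

Lemma rk_gt1_of_pair i j z : i != j -> m i <= z -> m j <= z -> (1 < rk z)%N.
Proof.
move=> ij iz jz; rewrite ltnNge; apply: contraNN ij => rz.
apply/eqP/m_inj; have -> : m i = z by apply: le_rk_eq; rewrite ?rk_m.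
by have -> : m j = z by apply: le_rk_eq; rewrite ?rk_m.
Qed.

(** By [card_below], passing from [v] to a lower cover loses exactly one minimal element; for [b]
    this is [i]. *)
Lemma cover_diff v a b i : covers S v a -> covers S v b ->
  m i <= a -> ~~ (m i <= b) -> forall h, m h <= v -> h != i -> m h <= b.
Proof.
move=> va vb ia ib h hv; have rb := covers_rk vb.
have le_v w t : covers S v w -> m t <= w -> m t <= v.
  by move=> vw tw; apply: le_trans tw (ltW (covers_lt vw)).
have : #|D v :\: D b| = 1%N.
  rewrite cardsD (setIidPr _) ?card_below; first by rewrite rb; nat_lia.
  by apply/subsetP => t; rewrite !inE; apply: le_v.
move/eqP/cards1P => [t Et].
have : i \in D v :\: D b by rewrite !inE ib (le_v a).
rewrite Et inE => /eqP ->; apply: contraNT => hb.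
have : h \in D v :\: D b by rewrite !inE hb.
by rewrite Et inE.
Qed.

(** No lower cover of the join bounds both elements, but each of the two is below some lower
    cover. *)
Lemma lub_covers i j z : i != j -> is_lub (m @: [set i; j]) z -> exists a b,
  [/\ a != b, lower_covers S z = [set a; b], m i <= a, m j <= b
    & ~~ (m i <= b) /\ ~~ (m j <= a)].
Proof.
move=> ij /is_lubP[iz jz lb]; have rz := rk_gt1_of_pair ij iz jz.
have [a [b [ab e _ _ zE]]] := lower_coversP rz.
have lt_z h : m h <= z -> m h < z.
  rewrite lt_neqAle => ->; rewrite andbT; apply/eqP => hz.
  by rewrite -hz rk_m in rz.
have nle w : w < z -> ~ (m i <= w /\ m j <= w).
  by move=> wz [iw jw]; have := lb w iw jw; rewrite (lt_geF wz).
have na := nle a; rewrite zE lexx in na.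
have nb := nle b; rewrite zE lexx orbT in nb.
have := lt_z i iz; have := lt_z j jz; rewrite !zE.
case/orP=> [ja|jb] /orP[ia|ib].
- by case: na.
- exists b, a; split=> //; rewrite 1?eq_sym // 1?setUC //.
  by split; apply/negP => H; [case: na|case: nb].
- exists a, b; split=> //.
  by split; apply/negP => H; [case: nb|case: na].
- by case: nb.
Qed.

(** Among the minimal elements below [z], the lower cover above [m i] misses only [j], so it also
    bounds [h]. *)
Lemma lub_third i j h z : i != j -> is_lub (m @: [set i; j]) z ->
    h != i -> h != j -> m h <= z ->
  exists2 x, is_lub (m @: [set i; h]) x & (rk x < rk z)%N.
Proof.
move=> ij Hz hi hj hz.
have [a [b [ab e ia jb [ib ja]]]] := lub_covers ij Hz.
have [za zb] := lower_covers_set2 e.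
have [x Hx xa] := lub_exists ia (cover_diff zb za jb ja hz hj).
by exists x => //; have := rk_le xa; have := covers_rk za; nat_lia.
Qed.

(** * Triangles of joins, conditioning vertices and the MAT conditions *)

Lemma no_triangle i j h x y z : m i <= z -> m j <= z -> m i <= x -> m h <= x ->
  m j <= y -> m h <= y -> [|| m i <= y, m j <= x | m h <= z].
Proof.
move=> iz jz ix hx jy hy; apply/negPn; rewrite !negb_or; apply/negP.
case/and3P=> /negbTE niy /negbTE njx /negbTE nhz.
(* The ideals are ordered so that each vertex lies below the ideal of its own index and the
   preceding one. *)
pose c t := nth i [:: i; j; h] (t %% 3); pose v t := nth z [:: z; y; x] (t %% 3).
have m3 t : ((t %% 3 == 0) || (t %% 3 == 1) || (t %% 3 == 2))%N by nat_lia.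
apply: (@no_ideal_cycle 3 1 (m \o c) v) => // [t|t|t|t|t r] /=.
- exact: rk_m.
- by rewrite /v modnDr.
- by rewrite /c /v; case/orP: (m3 t) => [/orP[]|] /eqP->.
- rewrite /c /v; case/orP: (m3 t) => [/orP[]|] /eqP e.
  + by have -> : ((t + 2) %% 3 = 2)%N by [nat_lia]; rewrite e.
  + by have -> : ((t + 2) %% 3 = 0)%N by [nat_lia]; rewrite e.
  + by have -> : ((t + 2) %% 3 = 1)%N by [nat_lia]; rewrite e.
- rewrite /c /v; case/orP: (m3 t) => [/orP[]|] /eqP e;
    case/orP: (m3 r) => [/orP[]|] /eqP e'; rewrite e e' /= ?niy ?njx ?nhz //; nat_lia.
Qed.

Lemma third_vertex_label_lt i j h z : i != j -> is_lub (m @: [set i; j]) z ->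
    h != i -> h != j -> m h <= z ->
  ([set i; h] \in E) && (lam [set i; h] < lam [set i; j])%N.
Proof.
move=> ij Hz hi hj hz; have [x Hx xz] := lub_third ij Hz hi hj hz.
rewrite (mem_vine_edges _ Hx) 1?eq_sym // (vine_labelE Hx) (vine_labelE Hz).
by have := rk_gt0 x; nat_lia.
Qed.

(** For a conditioning vertex [h], [no_triangle] on the three joins puts [h] below [z], since
    otherwise [z] would lie below a join of smaller rank. The converse is
    [third_vertex_label_lt]. *)
Lemma conditioning_verticesE i j z : i != j -> is_lub (m @: [set i; j]) z ->
  conditioning_vertices E lam [set i; j] = D z :\: [set i; j].
Proof.
move=> ij Hz; apply/setP => h; rewrite !inE.
have /is_lubP[iz jz lb] := Hz.
apply/'forall_implyP/andP => [H|[/norP[hi hj] hz] u].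
  have /andP[Ei li] := H i (set21 _ _); have /andP[Ej lj] := H j (set22 _ _).
  have hN (u : 'I_l) : [set u; h] \in E -> h != u.
    by rewrite inE cards2 [h == u]eq_sym; case: (u == h).
  rewrite negb_or !hN //; split=> //.
  move: Ei Ej li lj; rewrite !inE => /andP[_ /existsP[x Hx]] /andP[_ /existsP[y Hy]].
  rewrite (vine_labelE Hx) (vine_labelE Hy) (vine_labelE Hz) => xz yz.
  have /is_lubP[ix hx _] := Hx; have /is_lubP[jy hy _] := Hy.
  have /or3P[iy|jx|//] := no_triangle iz jz ix hx jy hy.
    by have := rk_le (lb _ iy jy); nat_lia.
  by have := rk_le (lb _ ix jx); nat_lia.
case/set2P=> ->; first exact: third_vertex_label_lt Hz hi hj hz.
rewrite [[set i; j]]setUC in Hz *.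
by apply: (third_vertex_label_lt _ Hz); rewrite // eq_sym.
Qed.

(** Of the [rk z] minimal elements below the join [z], removing [i] and [j] leaves [rk z - 2], one
    less than the label. *)
Lemma vine_ML2 k : ML2 E lam k.
Proof.
move=> e /vine_edgeP[i [j [z [-> ij Hz]]]].
rewrite (conditioning_verticesE ij Hz) (vine_labelE Hz) => <-.
have /is_lubP[iz jz _] := Hz.
rewrite cardsD (setIidPr _) ?card_below ?cards2 ?ij; first by nat_lia.
by apply/subsetP => h; rewrite !inE => /orP[]/eqP->.
Qed.

(* A chord of label at most k would split off a shorter such cycle avoiding the
   edge of label possibly below k; without chords the joins of consecutive
   vertices form a cycle of principal ideals. *)
Lemma no_label_cycle k n (f : nat -> 'I_l) : (2 < n)%N ->
    (forall s t, (s < n)%N -> (t < n)%N -> f s = f t -> s = t) ->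
    (forall t, (t.+1 < n)%N ->
       [set f t; f t.+1] \in E /\ lam [set f t; f t.+1] = k) ->
    [set f 0%N; f n.-1] \in E -> (lam [set f 0%N; f n.-1] <= k)%N ->
  False.
Proof.
elim/ltn_ind: n f => n IH f n2 f_inj fk fE fl.
have n0 : (0 < n)%N by nat_lia.
(* The disjunction excludes the closing edge, the only edge of the cycle whose label may be below
   [k]. *)
have no_chord p q : (p < q < n)%N -> (0 < p)%N || (q < n.-1)%N ->
    [set f p; f q] \in E -> (lam [set f p; f q] < k)%N -> False.
  case/andP=> pq qn pq' cE cl; case: (eqVneq q p.+1) => [eq_q|q_neq].
    by have [|_] := fk p; [nat_lia|rewrite -eq_q; nat_lia].
  have e : (p + (q - p).+1.-1 = q)%N by nat_lia.
  apply: (IH (q - p).+1 _ (fun t => f (p + t)%N)); rewrite ?addn0 ?e //; try nat_lia.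
    by move=> s t sn tn /f_inj; nat_lia.
  by move=> t tn; rewrite addnS; apply: fk; nat_lia.
pose g t := f (t %% n)%N.
have step t : (t %% n < n.-1)%N /\ (t.+1 %% n = (t %% n).+1)%N \/
    (t %% n = n.-1)%N /\ (t.+1 %% n = 0)%N.
  have tn := ltn_pmod t n0; have := modnDml t 1 n; rewrite !addn1 => <-.
  case: (ltnP (t %% n) n.-1) => c; [left|right]; split=> //.
  - by rewrite modn_small //; nat_lia.
  - nat_lia.
  - by have -> : (t %% n).+1 = n by [nat_lia]; rewrite modnn.
have gE t : [set g t; g t.+1] \in E /\ (lam [set g t; g t.+1] <= k)%N.
  rewrite /g; case: (step t) => -[e ->]; last by rewrite e setUC.
  by have [|-> ->] := fk (t %% n); first nat_lia.
have exv t : exists z, is_lub (m @: [set g t; g t.+1]) z.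
  by have [] := gE t; rewrite inE => /andP[_ /existsP].
(* The default is never taken, by [exv]. *)
pose v t := odflt (m (f 0%N)) [pick z | is_lub (m @: [set g t; g t.+1]) z].
have vP t : is_lub (m @: [set g t; g t.+1]) (v t).
  rewrite /v; case: pickP => [//|H]; have [z] := exv t; by rewrite H.
have gn t : g (t + n)%N = g t by rewrite /g modnDr.
apply: (@no_ideal_cycle n 1 (m \o g) v) => // [t|t|t|t|t r] /=.
- exact: rk_m.
- by rewrite /v -addSn !gn.
- by have /is_lubP[] := vP t.
- have /is_lubP[_ + _] := vP (t + n.-1)%N.
  by have -> : ((t + n.-1).+1 = t + n)%N by [nat_lia]; rewrite gn.
move=> tr; case: (eqVneq (r %% n) (t %% n))%N => [|ra]; first by left.
case: (eqVneq (r.+1 %% n) (t %% n))%N => [|rb]; first by right.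
(* A vertex [g t] below the join of an edge not containing it is adjacent to both ends with labels
   below [k]. The final cases pick one of these two edges that is not the closing edge, and apply
   [no_chord]. *)
exfalso; have /is_lubP[rv rSv _] := vP r.
have gN s : (s %% n != t %% n)%N -> g t != g s.
  by apply: contraNneq => /f_inj ->; rewrite // ltn_pmod.
have gr : g r != g r.+1.
  by have [+ _] := gE r; rewrite inE cards2; case: (g r != g r.+1).
have [_ le_k] := gE r.
have /andP[E1 l1] := third_vertex_label_lt gr (vP r) (gN _ ra) (gN _ rb) tr.
have /andP[E2 l2] : ([set g r.+1; g t] \in E) &&
    (lam [set g r.+1; g t] < lam [set g r; g r.+1])%N.
  have vPr := vP r; rewrite setUC in vPr; rewrite [[set g r; _]]setUC.
  by apply: (third_vertex_label_lt _ vPr); rewrite ?gN // eq_sym.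
have {}l1 := leq_trans l1 le_k; have {}l2 := leq_trans l2 le_k.
have tn := ltn_pmod t n0; have rn := ltn_pmod r n0.
move: ra rb E1 E2 l1 l2; rewrite /g.
case: (step r) => -[e ->] ra rb E1 E2 l1 l2; last first.
  by apply: (no_chord 0 (t %% n))%N => //; nat_lia.
case: (ltnP (t %% n) (r %% n)) => c.
  by rewrite setUC in E1 l1; apply: (no_chord (t %% n) (r %% n))%N => //; nat_lia.
by apply: (no_chord (r %% n).+1 (t %% n))%N => //; nat_lia.
Qed.

(** The cycle is rotated so that [e] becomes the closing edge in [no_label_cycle]. *)
Lemma vine_ML1 k : ML1 E lam k.
Proof.
move=> e c eE el [c2 /andP[cE uc]] /imsetP[x xc ex] H.
have [i s rs] := rot_to xc.
have us : uniq (x :: s) by rewrite -rs rot_uniq.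
have n_s (y : 'I_l) : next (x :: s) y = next c y by rewrite -rs next_rot.
have ss : size c = (size s).+1 by rewrite -(size_rot i) rs.
(* [nth x s] lists the cycle from the successor of [x] on: its default value supplies [x] as the
   last vertex, at index [size s]. *)
have nthr t : nth x s t = nth x (rcons s x) t.
  rewrite nth_rcons; case: ltngtP => // h; first by rewrite nth_default // ltnW.
  by rewrite nth_default // h.
have inj_s a b : (a < size c)%N -> (b < size c)%N -> nth x s a = nth x s b -> a = b.
  move=> ac bc /eqP; rewrite !nthr nth_uniq ?size_rcons -?ss //; first by move/eqP.
  by rewrite rcons_uniq.
have ns t : (t < size s)%N -> next c (nth x s t) = nth x s t.+1.
  move=> ts; rewrite -n_s next_nth inE mem_nth // orbT.
  by rewrite (@index_uniq _ x t.+1 (x :: s) ts us : index (nth x s t) _ = _).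
have n_x : next c x = nth x s 0.
  by rewrite -n_s next_nth mem_head /= eqxx.
have s_last : nth x s (size s) = x by rewrite nth_default.
apply: (@no_label_cycle k (size c) (nth x s)) => //; rewrite ss /=.
- move=> t ts; rewrite -ns //.
  have tc : nth x s t \in c by rewrite -(mem_rot i) rs inE mem_nth ?orbT.
  have fE : [set nth x s t; next c (nth x s t)] \in E := next_cycle cE tc.
  split=> //; apply: H; first by apply/imsetP; exists (nth x s t).
  have {}ex : e = [set nth x s (size s); nth x s 0] by rewrite s_last -n_x.
  (* An edge of the path equal to [e] would force [t = 0] and [size s = 1], a cycle with only two
     vertices. *)
  apply/eqP; rewrite ex ns // => f_e.
  have := set21 (nth x s t) (nth x s t.+1); have := set22 (nth x s t) (nth x s t.+1).
  have [ls zs] : (size s < size c)%N /\ (0 < size c)%N by rewrite ss.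
  have [t1c t0c] : (t.+1 < size c)%N /\ (t < size c)%N.
    by rewrite ss; split; last exact: ltnW.
  rewrite f_e => /set2P[/(inj_s _ _ t1c ls)|/(inj_s _ _ t1c zs)] // e1.
  case/set2P=> [/(inj_s _ _ t0c ls)|/(inj_s _ _ t0c zs)] e2.
    by move: e1; rewrite -e2 => /esym/n_Sn.
  by move: c2; rewrite ss -e1 e2.
- by rewrite s_last -n_x setUC -ex.
- by rewrite s_last -n_x setUC -ex.
Qed.

Lemma vine_MAT_labeled_graph : MAT_labeled_graph [set: 'I_l] E lam.
Proof.
split; last by move=> k _; split; [apply: vine_ML1|apply: vine_ML2].
split=> e; first by rewrite inE subsetT => /andP[/eqP].
move=> /vine_edgeP[i [j [z [-> ij Hz]]]]; rewrite (vine_labelE Hz).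
by have /is_lubP[iz jz _] := Hz; have := rk_gt1_of_pair ij iz jz; nat_lia.
Qed.

(** * Edges as conditioned sets *)

Lemma U_set_diff v a b i : covers S v a -> covers S v b ->
  m i <= a -> ~~ (m i <= b) -> U_set S a :\: U_set S b = [set m i].
Proof.
move=> va vb ia ib; rewrite !U_setE; apply/setP => x; rewrite !inE.
apply/andP/eqP => [[xb /imsetP[h ha xh]]|->]; last first.
  by rewrite !mem_imset // !inE.
move: xb; rewrite xh mem_imset // inE => hb; rewrite inE in ha.
congr m; apply: contraNeq hb; apply: (cover_diff va vb) => //.
by apply: le_trans ha (ltW (covers_lt va)).
Qed.

Lemma vine_edges_conditioned_sets (C : {set P}) :
  (exists2 e, e \in E & C = [set m i | i in e]) <->
  (exists2 v, v \notin minimals S & conditioned_set S v C).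
Proof.
split=> [[e0 /vine_edgeP[i [j [z [-> ij Hz]]]] ->]|[v v_min [a [b [ab e ->]]]]].
  have [a [b [ab e ia jb [ib ja]]]] := lub_covers ij Hz.
  have [za zb] := lower_covers_set2 e.
  exists z.
    have /is_lubP[iz jz _] := Hz.
    by rewrite mem_minimals; have := rk_gt1_of_pair ij iz jz; nat_lia.
  exists a, b; split=> //.
  by rewrite (U_set_diff za zb ia ib) (U_set_diff zb za jb ja) imsetU1 imset_set1.
have [va vb] := lower_covers_set2 e.
have rab : rk a = rk b by have := covers_rk va; have := covers_rk vb; nat_lia.
(* Otherwise, the cardinalities being equal, both lower covers and hence [v] would have the same
   minimal elements below them, against [N]. *)
have ex x y : x != y -> rk x = rk y -> covers S v x -> covers S v y ->
    exists2 i, m i <= x & ~~ (m i <= y).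
  move=> xy rxy vx vy.
  suff /subsetPn[i] : ~~ (D x \subset D y) by rewrite !inE => ix iy; exists i.
  apply/negP => xy'.
  have Dxy : D x = D y by apply/eqP; rewrite eqEcard xy' !card_below rxy /=.
  have : #|U_set S v| = #|U_set S x|.
    suff DE : D v = D x by rewrite !U_setE DE.
    have [|p [q [pq e' _ _ vE]]] := @lower_coversP v.
      by have := covers_rk vx; have := rk_gt0 x; nat_lia.
    have rv : (1 < rk v)%N by have := covers_rk vx; have := rk_gt0 x; nat_lia.
    have /[!inE] x' : x \in [set p; q] by rewrite -e' inE.
    have /[!inE] y' : y \in [set p; q] by rewrite -e' inE.
    have Dpq : D p = D x /\ D q = D x.
      by case/orP: x' y' xy Dxy => /eqP-> /orP[]/eqP-> //; rewrite eqxx.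
    apply/setP => h; have <- : (h \in D p :|: D q) = (h \in D x).
      by case: Dpq => -> ->; rewrite setUid.
    rewrite !inE -vE lt_neqAle; case: eqP => [hv|//].
    by rewrite -hv rk_m in rv.
  by rewrite !N (covers_rk vx); nat_lia.
have ba : b != a by rewrite eq_sym.
have [i ia ib] := ex a b ab rab va vb.
have [j jb ja] := ex b a ba (esym rab) vb va.
have ij : i != j by apply: contraNneq ja => <-.
have [z Hz _] := lub_exists (le_trans ia (ltW (covers_lt va)))
                            (le_trans jb (ltW (covers_lt vb))).
exists [set i; j]; first exact: mem_vine_edges Hz.
by rewrite (U_set_diff va vb ia ib) (U_set_diff vb va jb ja) imsetU1 imset_set1.
Qed.

End VineTheory.

(** * The required properties of LR-vines and R-vines *)

Section FromRVines.
Variables (d : Order.disp_t) (P : finPOrderType d) (rk : P -> nat).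
Implicit Types x y v w : P.
Local Notation S := [set: P].

Lemma poset_rank_ideal v : vine S rk -> poset_rank (ideal S v) rk = rk v.
Proof.
move=> V; apply/eqP; rewrite eqn_leq; apply/andP; split.
  by apply/bigmax_leqP => x; rewrite !inE /=; apply: rk_le.
by apply: (leq_bigmax_cond (F := rk)); rewrite !inE /=.
Qed.

Lemma LR_vine_connected_ideals : LR_vine S rk -> connected_ideals rk.
Proof.
case=> V R u x y xu yu rxy.
have [|_ _] := R_vine_tree (R u (in_setT u)) (i := rk x).
  by rewrite (poset_rank_ideal _ V) rk_gt0 // rk_le.
by apply; rewrite !inE /= ?xu ?yu ?rxy /=.
Qed.

(** Equality of rank and dimension in the ideal of [v], whose minimal elements are those of the
    poset below [v]. *)
Lemma LR_vine_card_U_set v : LR_vine S rk -> #|U_set S v| = rk v.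
Proof.
case=> V R; rewrite -(poset_rank_ideal v V) (R_vine_rank (R v (in_setT v))).
congr #|pred_of_set _|; apply/setP => x; rewrite !inE /= andbC.
case: (boolP (x <= v)) => //= xv.
apply/forallP/forallP => H y; have := H y; rewrite !inE /=; first by case: (y <= v).
case: (boolP (y < x)) => [yx|]; last by rewrite implybT.
by rewrite (ltW (lt_le_trans yx xv)).
Qed.

(** Distinct elements of one level are connected in its tree, so both have covers; since ranks are
    bounded, passing to covers ends with equal elements. *)
Lemma R_vine_upper_bound x y : R_vine S rk -> rk x = rk y ->
  exists w, x <= w /\ y <= w.
Proof.
move=> R; have V := R_vine_vine R.
have rk_max z : (rk z <= poset_rank S rk)%N.
  by apply: (leq_bigmax_cond (F := rk)); rewrite inE.
have : (poset_rank S rk < rk x + (poset_rank S rk).+1)%N by rewrite addnS ltnS leq_addl.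
move: {2}(poset_rank S rk).+1 => n; elim: n x y => [|n IH] x y xn rxy.
  by have := leq_ltn_trans (rk_max x) xn; rewrite addn0 ltnn.
case: (eqVneq x y) => [->|xy]; first by exists y.
have lift a b : a != b -> rk a = rk x -> rk b = rk x ->
    exists2 z, a <= z & rk z = (rk a).+1.
  move=> ab ra rb.
  have [|_ _ C] := R_vine_tree R (i := rk a); first by rewrite rk_gt0 // rk_max.
  have [||p /imsetP[z _ /esym e] _] := connect_first_step ab (C a b _ _);
    rewrite ?inE ?ra ?rb ?eqxx //.
  have [za _] := lower_covers_set2 e.
  by exists z; [exact: ltW (covers_lt za)|rewrite (covers_rk V za) ra].
have [x' xx' rx'] := lift x y xy erefl (esym rxy).
have [|y' yy' ry'] := lift y x _ (esym rxy) erefl; first by rewrite eq_sym.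
have [||w [x'w y'w]] := IH x' y'; first by rewrite rx' addSnnS.
  by rewrite rx' ry' rxy.
by exists w; split; [apply: le_trans x'w|apply: le_trans y'w].
Qed.

End FromRVines.

Theorem theorem5p17 (d : Order.disp_t) (P : finPOrderType d) (rk : P -> nat)
    (l : nat) (m : 'I_l -> P) (m_inj : injective m)
    (m_min : [set m i | i : 'I_l] = minimals [set: P]) :
  (LR_vine [set: P] rk ->
     MAT_labeled_graph [set: 'I_l] (vine_edges m) (vine_label rk m) /\
     (forall C : {set P},
        (exists2 e, e \in vine_edges m & C = [set m i | i in e]) <->
        (exists2 v, v \notin minimals [set: P] & conditioned_set [set: P] v C)))
  /\
  (R_vine [set: P] rk ->
     MAT_labeled_graph [set: 'I_l] (vine_edges m) (vine_label rk m) /\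
     complete_graph [set: 'I_l] (vine_edges m)).
Proof.
split=> [LR|R].
  have V := proj1 LR; have K := LR_vine_connected_ideals LR.
  have N v := LR_vine_card_U_set v LR.
  split; first exact: vine_MAT_labeled_graph.
  by move=> C; apply: (vine_edges_conditioned_sets V K N m_inj m_min).
(* For an R-vine both properties come directly from proximity, without going through LR-vines. *)
have V := R_vine_vine R; have prox := R_vine_proximity R.
have K := proximity_connected_ideals V prox.
have N v := proximity_card_U_set V K v prox.
split; first exact: vine_MAT_labeled_graph.
apply/setP => e; rewrite !inE subsetT /=.
case: (boolP (#|e| == 2%N)) => //= /cards2P[i [j [ij ->]]].
have [|w [iw jw]] := @R_vine_upper_bound _ P rk (m i) (m j) R.
  by rewrite !(rk_m V m_min).
have [z Hz _] := lub_exists V K m_min iw jw.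
by apply/existsP; exists z.
Qed.
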